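(* Assume that the kernels satisfy $0\le k^j(x,x')\le K^j$ for all $x,x'\in\mathbb X^j$ and $j\in[d]$. Then $$\sup_{\boldsymbol\pi}\ \sup_{\substack{\mathcal X_n,\tilde{\mathcal X}_n:\\ d_{\mathrm{ham}}(\mathcal X_n,\tilde{\mathcal X}_n)\le1}}\big|\widehat{\mathrm{dHSIC}}(\mathcal X_n^{\boldsymbol\pi})-\widehat{\mathrm{dHSIC}}(\tilde{\mathcal X}_n^{\boldsymbol\pi})\big|\le\frac{2d}{n}\Big(\prod_{j=1}^dK^j\Big)^{1/2},$$ where the first supremum is over all $d$-tuples $\boldsymbol\pi=(\pi^1,\dots,\pi^d)$ of permutations of $[n]$ and the second is over all pairs of datasets of size $n$ in $\mathbb X^1\times\dots\times\mathbb X^d$ at Hamming distance at most $1$.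
   Context: Superscripts $j\in[d]=\{1,\dots,d\}$ are indices, not exponents; $d\ge2$. For each $j$, $\mathbb X^j$ is a separable topological space and $k^j:\mathbb X^j\times\mathbb X^j\to\mathbb R$ is a continuous, bounded, positive semi-definite kernel with RKHS $\mathcal H^j$. The tensor product kernel is $\mathbf k((x^1,\dots,x^d),(x'^1,\dots,x'^d))=\prod_{j=1}^dk^j(x^j,x'^j)$ with RKHS $\mathcal H_{\mathbf k}=\mathcal H^1\otimes\dots\otimes\mathcal H^d$; it is assumed characteristic (the mean embedding of probability distributions is injective). $\mathcal F_{\mathbf k}$ is the unit ball of $\mathcal H_{\mathbf k}$. For a dataset $\mathcal X_n=(\mathbf X_1,\dots,\mathbf X_n)$ with $\mathbf X_i=(X_i^1,\dots,X_i^d)$, $$\widehat{\mathrm{dHSIC}}(\mathcal X_n)=\sup_{f\in\mathcal F_{\mathbf k}}\Big\{\frac1n\sum_{i=1}^nf(X_i^1,\dots,X_i^d)-\frac1{n^d}\sum_{(i_1,\dots,i_d)\in[n]^d}f(X_{i_1}^1,\dots,X_{i_d}^d)\Big\}.$$ For $\boldsymbol\pi=(\pi^1,\dots,\pi^d)$, $\mathcal X_n^{\boldsymbol\pi}$ is the dataset whose $i$-th element is $(X^1_{\pi^1(i)},\dots,X^d_{\pi^d(i)})$. Hamming distance: $d_{\mathrm{ham}}(\mathcal X_n,\tilde{\mathcal X}_n)=\sum_{i=1}^n\mathbb 1(\mathbf X_i\ne\tilde{\mathbf X}_i)$. *)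

(* Defs.v *)
From HB Require Import structures.
From mathcomp Require Import all_boot all_order all_algebra all_fingroup.
From mathcomp Require Import sesquilinear.
From mathcomp Require Import lra.
From mathcomp Require Import all_classical all_reals all_analysis.

Set Implicit Arguments.
Unset Strict Implicit.
Unset Printing Implicit Defensive.

Import Order.TTheory GRing.Theory Num.Theory.
Import numFieldNormedType.Exports.

Local Open Scope classical_set_scope.
Local Open Scope ring_scope.

Definition separable_space (T : topologicalType) : Prop :=
  exists2 S : set T, countable S & dense S.

Definition psd_kernel (R : realType) (X : Type) (k : X -> X -> R) : Prop :=
  (forall x y, k x y = k y x) /\
  (forall (m : nat) (a : 'I_m -> R) (x : 'I_m -> X),
    0 <= \sum_(i < m) \sum_(j < m) a i * a j * k (x i) (x j)).

Definition continuous_kernel (R : realType) (X : topologicalType)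
    (k : X -> X -> R) : Prop :=
  continuous (fun z : X * X => k z.1 z.2).

Definition bounded_kernel (R : realType) (X : Type) (k : X -> X -> R) : Prop :=
  exists M : R, forall x y, `|k x y| <= M.

(* A Hilbert space of functions with the reproducing property for k.  The
   injective linear map rkhs_eval identifies an element of the space with a
   function on X.  By the Moore-Aronszajn theorem, such a structure exists for
   every psd kernel, and its range and inner product are uniquely determined
   by k.  For a product of kernels, it is the Hilbert tensor product of the RKHSs
   of the factors, up to isometry. *)
Record rkhs (R : realType) (X : Type) (k : X -> X -> R) := Rkhs {
  rkhs_space :> completeNormedModType R ;
  rkhs_dot : {dot rkhs_space for idfun} ;
  rkhs_normE : forall f : rkhs_space, `|f| = Num.sqrt (rkhs_dot f f) ;
  rkhs_eval : {linear rkhs_space -> (X -> R)} ;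
  rkhs_eval_inj : injective rkhs_eval ;
  rkhs_reproducing : forall x : X, exists2 kx : rkhs_space,
    rkhs_eval kx = k ^~ x &
    forall f : rkhs_space, rkhs_eval f x = rkhs_dot f kx }.
Arguments rkhs_dot {R X k} r.
Arguments rkhs_eval {R X k} r.

Definition unit_ball (R : realType) (X : Type) (k : X -> X -> R)
  (H : rkhs k) : set H := [set f : H | `|f| <= 1].
Arguments unit_ball {R X k} H.

Definition tensor_kernel (R : realType) (d : nat) (X : 'I_d -> topologicalType)
    (k : forall j, X j -> X j -> R) (x x' : prod_topology X) : R :=
  \prod_(j < d) k j (x j) (x' j).

HB.instance Definition _ (I : Type) (T : I -> ptopologicalType) :=
  isPointed.Build (prod_topology T) (fun=> point).

Notation borel T := (g_sigma_algebraType (@open T)).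

Definition mean_embedding (R : realType) (T : ptopologicalType)
    (k : T -> T -> R) (P : probability (borel T) R) : T -> R :=
  fun y => Rintegral P setT (k ^~ y).

(* Terms of type probability are functions on all sets, whose values are
   only meaningful on measurable ones: equality of distributions is equality on
   Borel sets. *)
Definition characteristic_kernel (R : realType) (T : ptopologicalType)
    (k : T -> T -> R) : Prop :=
  forall P Q : probability (borel T) R,
    mean_embedding k P = mean_embedding k Q ->
    forall A : set (borel T), measurable A -> P A = Q A.

Definition dataset (d : nat) (X : 'I_d -> topologicalType) (n : nat) :=
  'I_n -> prod_topology X.

Definition permute (d : nat) (X : 'I_d -> topologicalType) (n : nat)
    (pi : 'I_d -> {perm 'I_n}) (D : dataset X n) : dataset X n :=
  fun i j => D (pi j i) j.

Definition hamming (d : nat) (X : 'I_d -> topologicalType) (n : nat)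
    (D D' : dataset X n) : nat :=
  (\sum_(i < n) `[< D i <> D' i >])%N.

Definition dHSIC_fun (R : realType) (d : nat) (X : 'I_d -> topologicalType)
    (n : nat) (D : dataset X n) (f : prod_topology X -> R) : R :=
  n%:R^-1 * (\sum_(i < n) f (D i)) -
  (n%:R ^+ d)^-1 *
    (\sum_(i : {ffun 'I_d -> 'I_n}) f (fun j => D (i j) j)).

Definition dHSIC (R : realType) (d : nat) (X : 'I_d -> topologicalType)
    (k : forall j, X j -> X j -> R) (H : rkhs (tensor_kernel k))
    (n : nat) (D : dataset X n) : R :=
  sup [set dHSIC_fun D (rkhs_eval H f) | f in unit_ball H].

Arguments dHSIC {R d X k} H {n} D.

(* The supremum defining dHSIC is always a genuine one. *)
Lemma dHSIC_has_sup (R : realType) (d : nat) (X : 'I_d -> topologicalType)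
    (k : forall j, X j -> X j -> R) (H : rkhs (tensor_kernel k))
    (n : nat) (D : dataset X n) :
  has_sup [set dHSIC_fun D (rkhs_eval H f) | f in unit_ball H].
Proof.
split.
  exists (dHSIC_fun D (rkhs_eval H 0)), 0 => //.
  by rewrite /unit_ball /= normr0.
have /choice[M HM] : forall x, exists M, forall f : H, `|f| <= 1 ->
    `|rkhs_eval H f x| <= M.
  move=> x; have [kx _ repr] := rkhs_reproducing H x.
  exists (1 + rkhs_dot H kx kx) => f f1.
  have d0 (g : H) : 0 <= rkhs_dot H g g.
    by have [->|g0] := eqVneq g 0; [rewrite linear0l | exact: ltW (neq0_dnorm_gt0 _ g0)].
  have dN (g : H) : `|g| ^+ 2 = rkhs_dot H g g.
    by rewrite rkhs_normE sqr_sqrtr.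
  have ff1 : rkhs_dot H f f <= 1 by rewrite -dN expr_le1.
  have sym : rkhs_dot H kx f = rkhs_dot H f kx.
    by rewrite hermitian_subproof expr0 mul1r.
  have := d0 (f - kx); have := d0 (f + kx).
  rewrite !(linearDl, linearDr, linearNl, linearNr, linearBl, linearBr) /= sym repr.
  have := d0 kx.
  by rewrite ler_norml; set a := rkhs_dot H f kx; lra.
exists (n%:R^-1 * (\sum_(i < n) M (D i)) + (n%:R ^+ d)^-1 *
    (\sum_(i : {ffun 'I_d -> 'I_n}) M (fun j => D (i j) j))).
move=> _ [f f1 <-]; rewrite /dHSIC_fun -mulrN lerD//.
  apply: ler_wpM2l; first by rewrite invr_ge0.
  by apply: ler_sum => i _; rewrite (le_trans (ler_norm _))// HM.
apply: ler_wpM2l; first by rewrite invr_ge0 exprn_ge0.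
rewrite -sumrN; apply: ler_sum => i _.
by rewrite (le_trans (ler_norm _))// normrN HM.
Qed.

(* Main.v *)
Require Import Defs.
From HB Require Import structures.
From mathcomp Require Import all_boot all_order all_algebra all_fingroup.
From mathcomp Require Import sesquilinear.
From mathcomp Require Import all_classical all_reals all_analysis.
From mathcomp Require Import ring lra.

Import Order.TTheory GRing.Theory Num.Theory.
Import numFieldNormedType.Exports.

Local Open Scope classical_set_scope.
Local Open Scope ring_scope.

(** dHSIC is the norm of the signed kernel combination
    V(D) = sum_e w(e) phi(D_e), where e ranges over the tuples of indices in
    [n]^d, D_e is the point whose j-th coordinate is the j-th coordinate of
    observation e(j), phi is the feature map of the tensor kernel, and w is the
    difference between the uniform weight on the n tuples (pi^1(i), ..., pi^d(i))
    and the uniform weight on all n^d tuples.  Permuting the data only changes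
    which tuples form the first of these two distributions.

    Replacing a whole observation i0 at once and bounding the two empirical
    means separately loses a factor sqrt 2.  Instead its coordinates are
    replaced one at a time, in d steps that each move dHSIC by at most
    2/n sqrt (prod_j K^j).  Replacing x by y in coordinate j only affects the
    tuples with e(j) = i0, and there the change of V is an elementary tensor
      (phi^j(x) - phi^j(y)) (x) sum_(e | e j = i0) w(e) psi_e,
    with psi_e the tensor of the other features.  By nonnegativity of k^j, the
    first factor has squared norm at most 2 K^j.  The second is a difference of
    two positive combinations of total mass 1/n each, because each coordinate of
    either distribution is uniform on [n]; by nonnegativity of the other kernels
    the mixed terms only help, and its squared norm is at most
    2/n^2 prod_(l != j) K^l.

    Everything is carried out on Gram matrices: a combination of evaluations is
    bounded by the Cauchy-Schwarz inequality (rkhs_eval_differences_le), its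
    Gram matrix factors through coordinate j (tensor_kernel_change_coord), and
    the two factors are bounded by kernel_difference_bounds and
    signed_gram_le. *)

(** * Evaluation functionals in a reproducing kernel Hilbert space *)

Section RKHS.
Context {R : realType} {X : Type} {k : X -> X -> R} (H : rkhs k).
Implicit Types f g : H.

Lemma rkhs_dotC f g : rkhs_dot H f g = rkhs_dot H g f.
Proof. by rewrite hermitian_subproof expr0 mul1r. Qed.

Lemma rkhs_dot_ge0 f : 0 <= rkhs_dot H f f.
Proof.
by have [->|f0] := eqVneq f 0; [rewrite linear0l | exact: ltW (neq0_dnorm_gt0 _ f0)].
Qed.

Lemma rkhs_Cauchy_Schwarz f g : `|rkhs_dot H f g| <= `|f| * `|g|.
Proof.
rewrite !rkhs_normE -sqrtrM ?rkhs_dot_ge0// -sqrtr_sqr ler_sqrt; last first.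
  by rewrite mulr_ge0 ?rkhs_dot_ge0.
have [->|g0] := eqVneq g 0; first by rewrite !linear0r expr0n.
have gg0 : 0 < rkhs_dot H g g by exact: neq0_dnorm_gt0.
have := rkhs_dot_ge0 (rkhs_dot H g g *: f - rkhs_dot H f g *: g).
rewrite linearBl !linearBr /= !linearZl_LR !linearZr_LR /= (rkhs_dotC g f).
move=> h; rewrite -subr_ge0 -(pmulr_rge0 _ gg0); apply: le_trans h _.
by rewrite le_eqVlt; apply/orP; left; apply/eqP; rewrite /GRing.scale /=; ring.
Qed.

(** The Riesz representer of the functional on the left is the same
    combination of kernel sections, and the double sum is its squared norm. *)
Lemma rkhs_eval_differences_le (I : finType) (P : pred I) (c : I -> R)
    (x y : I -> X) f :
  `|\sum_(a | P a) c a * (rkhs_eval H f (x a) - rkhs_eval H f (y a))| <=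
  `|f| * Num.sqrt (\sum_(a | P a) \sum_(b | P b) c a * c b *
    (k (x a) (x b) - k (x a) (y b) - k (y a) (x b) + k (y a) (y b))).
Proof.
have /choice[phi phiP] : forall z, exists kz : H,
    rkhs_eval H kz = k ^~ z /\ forall g, rkhs_eval H g z = rkhs_dot H g kz.
  by move=> z; have [kz ? ?] := rkhs_reproducing H z; exists kz.
have dotphi u v : rkhs_dot H (phi u) (phi v) = k u v.
  by rewrite rkhs_dotC -(phiP u).2 (phiP v).1.
pose v : H := \sum_(a | P a) c a *: (phi (x a) - phi (y a)).
have -> : \sum_(a | P a) c a * (rkhs_eval H f (x a) - rkhs_eval H f (y a)) =
    rkhs_dot H f v.
  rewrite linear_sumr; apply: eq_bigr => a _.
  by rewrite linearZr_LR /= !(phiP _).2 (linearBr (rkhs_dot H)) /GRing.scale.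
apply: le_trans (rkhs_Cauchy_Schwarz f v) _.
rewrite (rkhs_normE v) le_eqVlt; apply/orP; left; apply/eqP.
congr (_ * Num.sqrt _).
rewrite {1}/v linear_sumlz; apply: eq_bigr => a _.
rewrite linearZl_LR /= linear_sumr mulr_sumr; apply: eq_bigr => b _.
rewrite linearZr_LR linearBl !linearBr /= !dotphi /GRing.scale /=.
ring.
Qed.

End RKHS.

(** * Gram estimates for nonnegative kernels *)

(** Nonnegativity of k is what makes the upper bound 2 K rather than 4 K. *)
Lemma kernel_difference_bounds (R : realType) (X : Type) (k : X -> X -> R)
    (K : R) (x y : X) :
  psd_kernel k -> (forall u v, 0 <= k u v <= K) ->
  0 <= k x x - k x y - k y x + k y y <= 2%:R * K.
Proof.
move=> [_ psd] kK; apply/andP; split.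
  have := psd 2 (fun i => (-1) ^+ i) (fun i => if i == 0 then x else y).
  rewrite !big_ord_recl !big_ord0 /= /bump /=.
  by rewrite expr0 expr1; lra.
have /andP[_ ?] := kK x x; have /andP[_ ?] := kK y y.
have /andP[? _] := kK x y; have /andP[? _] := kK y x; lra.
Qed.

(** Positivity of the entries allows the mixed terms, which have a negative
    coefficient, to be dropped. *)
Lemma signed_gram_le (R : realDomainType) (I : finType) (P : pred I)
    (p q : I -> R) (G : I -> I -> R) (M : R) :
  (forall a, 0 <= p a) -> (forall a, 0 <= q a) ->
  (forall a b, 0 <= G a b <= M) ->
  \sum_(a | P a) \sum_(b | P b) (p a - q a) * (p b - q b) * G a b <=
  ((\sum_(a | P a) p a) ^+ 2 + (\sum_(a | P a) q a) ^+ 2) * M.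
Proof.
move=> p0 q0 GM; rewrite !expr2 !mulr_suml -big_split /= mulr_suml.
apply: ler_sum => a _; rewrite !mulr_sumr -big_split /= mulr_suml.
apply: ler_sum => b _.
have /andP[G0 GleM] := GM a b.
have pp : 0 <= p a * p b by exact: mulr_ge0.
have qq : 0 <= q a * q b by exact: mulr_ge0.
have pq : 0 <= (p a * q b + q a * p b) * G a b.
  by rewrite mulr_ge0// addr_ge0// mulr_ge0.
have : (p a * p b + q a * q b) * G a b <= (p a * p b + q a * q b) * M.
  by rewrite ler_wpM2l// addr_ge0.
lra.
Qed.

(** * The dHSIC functional as a weighted sum over index tuples *)

Section Weights.
Context {R : realType} {d n : nat} {X : 'I_d -> topologicalType}.
Implicit Types (D : dataset X n) (pi : 'I_d -> {perm 'I_n})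
  (e : {ffun 'I_d -> 'I_n}).

Definition resample D e : prod_topology X := fun j => D (e j) j.

Definition aligned_weight pi e : R :=
  n%:R^-1 * \sum_(i < n) (e == [ffun j => pi j i])%:R.

Definition uniform_weight : R := (n%:R ^+ d)^-1.

(** A permutation of each coordinate permutes the set of all index tuples, so
    the product empirical distribution is unaffected by pi. *)
Lemma dHSIC_fun_permute pi D (f : prod_topology X -> R) :
  dHSIC_fun (permute pi D) f =
  \sum_e (aligned_weight pi e - uniform_weight) * f (resample D e).
Proof.
under [RHS]eq_bigr do rewrite mulrBl.
rewrite sumrB /dHSIC_fun; congr (_ - _).
  under [RHS]eq_bigr do rewrite /aligned_weight -mulrA mulr_suml.
  rewrite -mulr_sumr exchange_big /=; congr (_ * _).
  apply: eq_bigr => i _; rewrite (bigD1 [ffun j => pi j i]) //= eqxx mul1r.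
  rewrite big1 ?addr0 => [|e /negPf->]; last by rewrite mul0r.
  by congr f; apply: functional_extensionality_dep => j;
    rewrite /permute /resample ffunE.
rewrite -mulr_sumr; congr (_ * _).
have pi_bij : bijective (fun e : {ffun 'I_d -> 'I_n} => [ffun j => pi j (e j)]).
  exists (fun e => [ffun j => ((pi j)^-1)%g (e j)]) => e;
    by apply/ffunP => j; rewrite !ffunE ?permK ?permKV.
rewrite [RHS](reindex _ (onW_bij _ pi_bij)); apply: eq_bigr => e _.
by congr f; apply: functional_extensionality_dep => j;
  rewrite /permute /resample ffunE.
Qed.

Lemma aligned_weight_ge0 pi e : 0 <= aligned_weight pi e.
Proof. by rewrite mulr_ge0 ?invr_ge0// sumr_ge0. Qed.

(** Coordinate j of the i-th aligned tuple is pi^j(i), which equals i0 for exactly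
    one i. *)
Lemma sum_aligned_weight pi (j : 'I_d) (i0 : 'I_n) :
  \sum_(e : {ffun 'I_d -> 'I_n} | e j == i0) aligned_weight pi e = n%:R^-1.
Proof.
rewrite -mulr_sumr exchange_big /= -[RHS]mulr1; congr (_ * _).
rewrite (bigD1 (((pi j)^-1)%g i0)) //= [X in _ + X]big1 ?addr0 => [|i ne].
  rewrite (bigD1 [ffun l => pi l (((pi j)^-1)%g i0)]) /=; last first.
    by rewrite ffunE permKV.
  by rewrite eqxx big1 ?addr0// => e /andP[_ /negPf->].
rewrite big1// => e /eqP ej; case: eqP => // ee; case/eqP: ne.
by rewrite -ej ee ffunE permK.
Qed.

Lemma sum_uniform_weight (j : 'I_d) (i0 : 'I_n) :
  \sum_(e : {ffun 'I_d -> 'I_n} | e j == i0) uniform_weight = n%:R^-1.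
Proof.
have n0 : (n%:R : R) != 0.
  by rewrite pnatr_eq0 -lt0n (leq_trans _ (ltn_ord i0)).
pose F l : pred 'I_n := if l == j then pred1 i0 else predT.
have FE e : (e j == i0) = (e \in family F).
  apply/idP/familyP => [ej l|/(_ j)]; rewrite /F; last by rewrite eqxx.
  by case: eqP => [->|].
rewrite (eq_bigl (mem (family F))) // sumr_const card_family foldrE big_map big_enum /=.
rewrite (bigD1 j) //= {1}/F eqxx card1 mul1n.
rewrite (eq_bigr (fun=> n)) => [|l /negPf lj]; last by rewrite /F lj card_ord.
rewrite prod_nat_const cardC1 card_ord -(mulr_natr uniform_weight) natrX /uniform_weight.
have d0 : (0 < d)%N by exact: leq_trans (ltn_ord j).
by rewrite -{1}(prednK d0) exprS invfM mulfVK// expf_neq0.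
Qed.

End Weights.

(** * Replacing one observation, one coordinate at a time *)

Lemma sup_image_dist_le (R : realType) (T : Type) (A : set T) (F G : T -> R)
    (C : R) :
  has_sup (F @` A) -> has_sup (G @` A) ->
  (forall t, A t -> `|F t - G t| <= C) ->
  `|sup (F @` A) - sup (G @` A)| <= C.
Proof.
move=> [F0 Fub] [G0 Gub] FG.
suff half (f g : T -> R) : f @` A !=set0 -> has_ubound (g @` A) ->
    (forall t, A t -> `|f t - g t| <= C) -> sup (f @` A) <= sup (g @` A) + C.
  rewrite ler_norml; apply/andP; split.
    by rewrite lerBrDl lerBlDr half// => t At; rewrite distrC FG.
  by rewrite lerBlDl half.
move=> f0 gub fg; apply: ge_sup f0 _ => _ [t At <-].
have gt : g t <= sup (g @` A) by apply: ub_le_sup => //; exists t.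
have := fg t At; rewrite ler_norml => /andP[_]; lra.
Qed.

(** The three datasets agree off coordinate j, so the j-th kernel value splits off
    and the remaining product is the same whichever of D, E, F is sampled. *)
Lemma tensor_kernel_change_coord (R : realType) (d n : nat)
    (X : 'I_d -> topologicalType) (k : forall j, X j -> X j -> R)
    (D E F : dataset X n) (i0 : 'I_n) (j : 'I_d)
    (e e' : {ffun 'I_d -> 'I_n}) :
  (forall i l, l != j -> E i l = D i l) ->
  (forall i l, l != j -> F i l = D i l) ->
  e j = i0 -> e' j = i0 ->
  tensor_kernel k (resample E e) (resample F e') =
  k j (E i0 j) (F i0 j) *
  \prod_(l < d | l != j) k l (D (e l) l) (D (e' l) l).
Proof.
move=> ED FD ej e'j; rewrite /tensor_kernel (bigD1 j) //= /resample ej e'j.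
by congr (_ * _); apply: eq_bigr => l lj; rewrite ED// FD.
Qed.

Section Sensitivity.
Context {R : realType} {d n : nat} {X : 'I_d -> topologicalType}
  {k : forall j, X j -> X j -> R} (H : rkhs (tensor_kernel k)) {K : 'I_d -> R}.
Context (pk : forall j, psd_kernel (k j)).
Context (kK : forall (j : 'I_d) (x x' : X j), 0 <= k j x x' <= K j).
Implicit Types (D E : dataset X n) (pi : 'I_d -> {perm 'I_n}).

(** The Gram matrix of the change of V is the scalar c, the squared norm
    of phi^j(x) - phi^j(y), times the Gram matrix G of the other coordinates; the
    weights w are a difference of two positive weights of mass 1/n on the tuples
    through i0.  Hence the squared norm is at most 2 K^j (2/n^2) M. *)
Lemma dHSIC_fun_change_coord pi D E (i0 : 'I_n) (j : 'I_d) (f : H) :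
  (forall i l, (i != i0) || (l != j) -> E i l = D i l) -> `|f| <= 1 ->
  `|dHSIC_fun (permute pi D) (rkhs_eval H f) -
    dHSIC_fun (permute pi E) (rkhs_eval H f)| <=
  2%:R / n%:R * Num.sqrt (\prod_(l < d) K l).
Proof.
move=> DE f1; rewrite !dHSIC_fun_permute -sumrB.
have K0 l : 0 <= K l by have /andP[] := kK l (D i0 l) (D i0 l); exact: le_trans.
pose w e : R := aligned_weight pi e - uniform_weight (d := d) (n := n).
pose M := \prod_(l < d | l != j) K l.
have M0 : 0 <= M by exact: prodr_ge0.
have -> : \sum_e ((aligned_weight pi e - uniform_weight (d := d) (n := n)) *
      rkhs_eval H f (resample D e) -
    (aligned_weight pi e - uniform_weight (d := d) (n := n)) *
      rkhs_eval H f (resample E e)) =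
    \sum_(e : {ffun 'I_d -> 'I_n} | e j == i0) w e *
      (rkhs_eval H f (resample D e) - rkhs_eval H f (resample E e)).
  rewrite [RHS]big_mkcond; apply: eq_bigr => e _; rewrite -mulrBr.
  case: eqP => // /eqP ej.
  suff -> : resample E e = resample D e by rewrite subrr mulr0.
  apply: functional_extensionality_dep => l; apply: DE.
  by case: (eqVneq l j) => [->|_]; rewrite ?ej ?orbT.
apply: le_trans (rkhs_eval_differences_le _ _ _ _ _ _ _) _.
apply: le_trans (ler_piMl (sqrtr_ge0 _) f1) _.
have -> : 2%:R / n%:R * Num.sqrt (\prod_(l < d) K l) =
    Num.sqrt ((2%:R / n%:R) ^+ 2 * \prod_(l < d) K l).
  by rewrite sqrtrM ?sqr_ge0// sqrtr_sqr ger0_norm.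
apply: ler_wsqrtr; rewrite [X in _ <= _ * X](bigD1 j) //= -/M.
have ED i l : l != j -> E i l = D i l by move=> lj; rewrite DE// lj orbT.
pose c := k j (D i0 j) (D i0 j) - k j (D i0 j) (E i0 j)
  - k j (E i0 j) (D i0 j) + k j (E i0 j) (E i0 j).
pose G e e' := \prod_(l < d | l != j) k l (D (e l) l) (D (e' l) l).
have -> : \sum_(e : {ffun 'I_d -> 'I_n} | e j == i0)
    \sum_(e' : {ffun 'I_d -> 'I_n} | e' j == i0) w e * w e' *
      (tensor_kernel k (resample D e) (resample D e')
       - tensor_kernel k (resample D e) (resample E e')
       - tensor_kernel k (resample E e) (resample D e')
       + tensor_kernel k (resample E e) (resample E e')) =
    c * \sum_(e : {ffun 'I_d -> 'I_n} | e j == i0)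
      \sum_(e' : {ffun 'I_d -> 'I_n} | e' j == i0) w e * w e' * G e e'.
  rewrite mulr_sumr; apply: eq_bigr => e /eqP ej.
  rewrite mulr_sumr; apply: eq_bigr => e' /eqP e'j.
  rewrite !(@tensor_kernel_change_coord _ _ _ _ _ D _ _ i0 j)//.
  by rewrite /c /G; ring.
have /andP[c0 cK] : 0 <= c <= 2%:R * K j by exact: kernel_difference_bounds.
have gram : \sum_(e : {ffun 'I_d -> 'I_n} | e j == i0)
    \sum_(e' : {ffun 'I_d -> 'I_n} | e' j == i0) w e * w e' * G e e' <=
    (n%:R^-1 ^+ 2 + n%:R^-1 ^+ 2) * M.
  rewrite -{1}(sum_aligned_weight pi j i0) -(sum_uniform_weight (d := d) j i0).
  apply: signed_gram_le => [e|_|e e'].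
  - exact: aligned_weight_ge0.
  - by rewrite /uniform_weight invr_ge0 exprn_ge0.
  - have k0 l : 0 <= k l (D (e l) l) (D (e' l) l)
      by have /andP[] := kK l (D (e l) l) (D (e' l) l).
    by rewrite prodr_ge0 //=; apply: ler_prod => l _; exact: kK.
apply: le_trans (ler_wpM2l c0 gram) _.
have -> : (2%:R / n%:R) ^+ 2 * (K j * M) =
    2%:R * K j * ((n%:R^-1 ^+ 2 + n%:R^-1 ^+ 2) * M) by ring.
by rewrite ler_wpM2r// mulr_ge0// addr_ge0// sqr_ge0.
Qed.

Lemma dHSIC_change_coord pi D E (i0 : 'I_n) (j : 'I_d) :
  (forall i l, (i != i0) || (l != j) -> E i l = D i l) ->
  `|dHSIC H (permute pi D) - dHSIC H (permute pi E)| <=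
  2%:R / n%:R * Num.sqrt (\prod_(l < d) K l).
Proof.
move=> DE; apply: sup_image_dist_le; [exact: dHSIC_has_sup..|].
by move=> f f1; exact: dHSIC_fun_change_coord DE f1.
Qed.

Lemma dHSIC_change_observation pi D E (i0 : 'I_n) :
  (forall i, i != i0 -> E i = D i) ->
  `|dHSIC H (permute pi D) - dHSIC H (permute pi E)| <=
  2%:R * d%:R / n%:R * Num.sqrt (\prod_(l < d) K l).
Proof.
move=> DE.
(* interpolates from D to E, changing a single coordinate at each step *)
pose hybrid m : dataset X n := fun i j => if (j < m)%N then E i j else D i j.
have hybridE : hybrid d = E.
  apply: funext => i; apply: functional_extensionality_dep => j.
  by rewrite /hybrid ltn_ord.
suff chain m : (m <= d)%N ->
    `|dHSIC H (permute pi D) - dHSIC H (permute pi (hybrid m))| <=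
    m%:R * (2%:R / n%:R * Num.sqrt (\prod_(l < d) K l)).
  have := chain d (leqnn d); rewrite hybridE => /le_trans; apply.
  by rewrite le_eqVlt; apply/orP; left; apply/eqP; ring.
elim: m => [_|m IHm md].
  have -> : hybrid 0%N = D by [].
  by rewrite subrr normr0 mul0r.
apply: le_trans (ler_distD (dHSIC H (permute pi (hybrid m))) _ _) _.
rewrite -natr1 mulrDl mul1r lerD ?IHm ?(ltnW md)//.
apply: (@dHSIC_change_coord _ _ _ i0 (Ordinal md)) => i l.
rewrite /hybrid ltnS leq_eqVlt -(val_eqE l) /=.
case: (eqVneq i i0) => [_ /= /negPf-> //|/DE-> _].
by case: ifP; case: ifP.
Qed.

End Sensitivity.

Lemma hamming_le1 (d n : nat) (X : 'I_d -> topologicalType)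
    (D E : dataset X n) : (0 < n)%N -> (hamming D E <= 1)%N ->
  exists i0, forall i, i != i0 -> E i = D i.
Proof.
move=> n0 DE.
have [eqDE|/existsNP[i0 /asboolT i0P]] := pselect (forall i, D i = E i).
  by exists (Ordinal n0) => i _; rewrite eqDE.
exists i0 => i ii0; apply/esym; apply: contrapT => /asboolT iP.
by move: DE; rewrite /hamming (bigD1 i0) //= (bigD1 i) //= i0P iP.
Qed.

Theorem proposition3p1 (R : realType) (d n : nat)
  (X : 'I_d -> ptopologicalType) (k : forall j : 'I_d, X j -> X j -> R)
  (H : rkhs (tensor_kernel k)) (K : 'I_d -> R)
  (d_ge2 : (2 <= d)%N) (n_gt0 : (0 < n)%N)
  (sepX : forall j, separable_space (X j))
  (ck : forall j, continuous_kernel (k j))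
  (bk : forall j, bounded_kernel (k j))
  (pk : forall j, psd_kernel (k j))
  (chark : characteristic_kernel (tensor_kernel k))
  (kK : forall (j : 'I_d) (x x' : X j), 0 <= k j x x' <= K j) :
  (ereal_sup [set ereal_sup
      [set `|dHSIC H (permute pi DD.1) - dHSIC H (permute pi DD.2)|%:E
      | DD in [set DD : dataset X n * dataset X n |
                (hamming DD.1 DD.2 <= 1)%N]]
    | pi in [set: 'I_d -> {perm 'I_n}]]
   <= (2%:R * d%:R / n%:R * Num.sqrt (\prod_(j < d) K j))%:E)%E.
Proof.
apply: ge_ereal_sup => _ [pi _ <-]; apply: ge_ereal_sup => _ [[D E] /= DE <-].
have [i0 i0P] := hamming_le1 _ _ _ _ _ n_gt0 DE.
by rewrite lee_fin; exact: dHSIC_change_observation i0P.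
Qed.
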